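(* Let $G$ be a finite nonabelian group with normal subgroups $G_1,\ldots,G_n$ such that $\bigcap_{i=1}^n G_i$ is trivial, and let $C$ be the quasi-uniform code generated by $G$ and $G_1,\ldots,G_n$. Then the minimum distance of $C$, namely the minimum of $wt(c)$ over all codewords $c\in C$ other than the identity codeword, is equal to $$n-\max_{\mathcal{A}\subseteq\mathcal{N},\ G_{\mathcal{A}}\ne\{1\}}|\mathcal{A}|,$$ where the weight $wt(c)$ is the number of components $c_i$ of $c$ which are not the identity element of $H_i$.
   Context: Let $n\ge 1$ and $\mathcal{N}=\{1,\ldots,n\}$. For $\mathcal{A}\subseteq\mathcal{N}$ put $G_{\mathcal{A}}=\bigcap_{i\in\mathcal{A}}G_i$, with $G_{\emptyset}=G$. For each $i$ let $\pi_i:G\to G/G_i$ be the canonical projection and $\psi_i:G/G_i\to H_i$ a group isomorphism onto a (possibly nonabelian) group $H_i$. The quasi-uniform code generated by $G$ and $G_1,\ldots,G_n$ is $C=\{(\psi_1(\pi_1(g)),\ldots,\psi_n(\pi_n(g))): g\in G\}\subseteq H_1\times\cdots\times H_n$. The identity codeword is $(1_{H_1},\ldots,1_{H_n})$. The minimum distance of $C$ is the minimum, over pairs $c\neq c'$ in $C$, of $|\{i: c_i\ne c_i'\}|$. *)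

(* Defs.v *)
From HB Require Import structures.
From mathcomp Require Import all_boot all_fingroup.

Set Implicit Arguments.
Unset Strict Implicit.
Unset Printing Implicit Defensive.

Local Open Scope group_scope.

Definition is_minimum (P : nat -> Prop) (m : nat) : Prop :=
  P m /\ forall k, P k -> (m <= k)%N.

(* Words are elements of the direct product group of the alphabets; the
   alphabets may be pairwise different and nonabelian. *)
Notation word hT := {dffun forall i, hT i}.

Definition hamming (n : nat) (hT : 'I_n -> finGroupType) (c c' : word hT) :
  nat := #|[set i | c i != c' i]|.

Definition wt (n : nat) (hT : 'I_n -> finGroupType) (c : word hT) : nat :=
  #|[set i | c i != 1]|.

Definition is_min_distance (n : nat) (hT : 'I_n -> finGroupType)
    (C : {set word hT}) (d : nat) : Prop :=
  is_minimum
    (fun k => exists c c' : word hT,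
       [/\ c \in C, c' \in C, c != c' & hamming c c' = k]) d.

(* Here 1 is the unit of the product group, the word all of whose components
   are 1. *)
Definition is_min_weight (n : nat) (hT : 'I_n -> finGroupType)
    (C : {set word hT}) (d : nat) : Prop :=
  is_minimum (fun k => exists c : word hT, [/\ c \in C, c != 1 & wt c = k]) d.

Definition codeword (gT : finGroupType) (n : nat)
    (hT : 'I_n -> finGroupType) (Gs : 'I_n -> {group gT})
    (psi : forall i, coset_of (Gs i) -> hT i) (g : gT) : word hT :=
  [ffun i : 'I_n => psi i (coset (Gs i) g) : hT i].

Definition quasi_uniform_code (gT : finGroupType) (n : nat)
    (hT : 'I_n -> finGroupType) (G : {group gT}) (Gs : 'I_n -> {group gT})
    (psi : forall i, coset_of (Gs i) -> hT i) : {set word hT} :=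
  [set codeword psi g | g in G].

(* The intersection is taken inside G, so that the empty family gives G; for
   subgroups Gs i of G and a nonempty A the factor G changes nothing. *)
Definition subgroup_cap (gT : finGroupType) (n : nat) (G : {group gT})
    (Gs : 'I_n -> {group gT}) (A : {set 'I_n}) : {set gT} :=
  G :&: \bigcap_(i in A) Gs i.

(* Main.v *)
Require Import Defs.
From mathcomp Require Import all_boot all_fingroup.

(** The map [g |-> codeword psi g] is a group morphism on [G], so the code is a
    subgroup of the product of the alphabets. For such a subgroup the Hamming
    distance of [c] and [c'] is the weight of [c^-1 * c'], which reduces the
    minimum distance to the minimum weight ([min_distance_group]).

    For [g] in [G], the component of index [i] of [codeword psi g] is trivial
    exactly when [g] lies in [Gs i], because [psi i] is injective. Write [Z g]
    for the set of these indices ([zero_set]). Then the weight of the codeword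
    of [g] is [n - #|Z g|] ([wt_codeword]), and the codeword differs from the identity
    if and only if [g != 1], because the [Gs i] have a trivial intersection. It
    remains to see that the largest [#|A|] with [subgroup_cap G Gs A != 1] is the
    largest [#|Z g|] with [g != 1] in [G]: a nontrivial [g] of [G] lies in
    [subgroup_cap G Gs A] if and only if [A \subset Z g]. The family of the
    admissible [A] is not empty since [G], being nonabelian, is nontrivial. *)

Section Words.

Variables (n : nat) (hT : 'I_n -> finGroupType).
Implicit Types c : word hT.
Local Open Scope group_scope.

Lemma hammingE c c' : hamming c c' = wt (c^-1 * c').
Proof.
apply: eq_card => i.
by rewrite !inE mulg_ffun invg_ffun -eq_mulVg1.
Qed.

Lemma min_distance_group (C : {set word hT}) (d : nat) :
  group_set C -> is_min_weight C d -> is_min_distance C d.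
Proof.
move=> gC [[c [Cc c_neq1 wtc]] min_d]; pose K := group gC.
split=> [|k [c1 [c2 [Cc1 Cc2 neq_c <-]]]].
- exists 1, c; split=> //; first exact: (group1 K).
    by rewrite eq_sym.
  by rewrite hammingE invg1 mul1g.
- apply: min_d; exists (c1^-1 * c2); split; last by rewrite hammingE.
    by apply: (@groupM _ K) => //; apply: (@groupVr _ K).
  by rewrite -eq_mulVg1.
Qed.

End Words.

Section Code.

Variables (gT : finGroupType) (n : nat) (G : {group gT}).
Variables (Gs : 'I_n -> {group gT}) (hT : 'I_n -> finGroupType).
Variable psi : forall i, {morphism (G / Gs i)%g >-> hT i}.
Hypothesis Gs_normal : forall i, (Gs i <| G)%g.

Local Open Scope group_scope.
Local Notation cw := (codeword (fun i => psi i : coset_of (Gs i) -> hT i)).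

Lemma codewordM : {in G &, {morph cw : x y / x * y}}.
Proof.
move=> x y Gx Gy; apply/ffunP=> i; rewrite mulg_ffun !ffunE.
have nG := subsetP (normal_norm (Gs_normal i)).
by rewrite morphM ?nG // morphM ?mem_quotient.
Qed.

Lemma quasi_uniform_code_group_set :
  group_set (quasi_uniform_code G (fun i => psi i : coset_of (Gs i) -> hT i)).
Proof.
rewrite (_ : quasi_uniform_code G _ = Morphism codewordM @* G) ?groupP //.
by rewrite morphimEdom.
Qed.

(** For [g] in [G] and injective [psi i], the set of the indices at which the
    codeword of [g] is trivial; see [codeword_eq1]. *)
Definition zero_set (g : gT) : {set 'I_n} := [set i | g \in Gs i].

Lemma mem_subgroup_cap (A : {set 'I_n}) (g : gT) :
  (g \in subgroup_cap G Gs A) = (g \in G) && (A \subset zero_set g).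
Proof.
rewrite inE; congr andb; apply/bigcapP/subsetP=> AZ i Ai.
  by rewrite inE AZ.
by have:= AZ i Ai; rewrite inE.
Qed.

Lemma subgroup_cap_neq1 (A : {set 'I_n}) :
  reflect (exists g, [/\ g \in G, g != 1 & A \subset zero_set g])
          (subgroup_cap G Gs A != 1).
Proof.
have -> : subgroup_cap G Gs A = (G :&: \bigcap_(i in A) Gs i)%G by [].
apply: (iffP (trivgPn _)) => [[g] | [g [Gg g_neq1 AZ]]].
  by rewrite mem_subgroup_cap => /andP[Gg AZ] g_neq1; exists g.
by exists g; rewrite // mem_subgroup_cap Gg.
Qed.

Section Injective.

Hypothesis psi_inj : forall i, 'injm (psi i).

Lemma codeword_eq1 (g : gT) (i : 'I_n) :
  g \in G -> (cw g i == 1) = (g \in Gs i).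
Proof.
move=> Gg; have nGg : g \in 'N(Gs i).
  exact: (subsetP (normal_norm (Gs_normal i))).
rewrite ffunE morph_injm_eq1 ?mem_quotient //.
by apply/eqP/idP=> [/coset_idr-> | /coset_id].
Qed.

Lemma wt_codeword (g : gT) : g \in G -> wt (cw g) = (n - #|zero_set g|)%N.
Proof.
move=> Gg; rewrite -[zero_set g]setCK -[X in (X - _)%N]card_ord -cardsCs.
by apply: eq_card => i; rewrite !inE codeword_eq1.
Qed.

Lemma codeword_neq1 (g : gT) :
  \bigcap_(i < n) Gs i = 1 :> {set gT} -> g \in G -> (cw g != 1) = (g != 1).
Proof.
move=> cap1 Gg; congr negb; apply/eqP/eqP=> [cg1 | ->]; last first.
  by apply/ffunP=> i; apply/eqP; rewrite oneg_ffun codeword_eq1 ?group1.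
apply/set1gP; rewrite -cap1; apply/bigcapP=> i _.
by rewrite -codeword_eq1 // cg1 oneg_ffun.
Qed.

End Injective.

End Code.

Arguments zero_set {gT n} Gs g.
Arguments subgroup_cap_neq1 {gT n G Gs A}.

Theorem corollary2 (gT : finGroupType) (n : nat) (n_gt0 : (0 < n)%N)
    (G : {group gT}) (Gs : 'I_n -> {group gT})
    (hT : 'I_n -> finGroupType) (H : forall i, {group hT i})
    (psi : forall i, {morphism (G / Gs i)%g >-> hT i})
    (G_nonabelian : ~~ abelian G)
    (Gs_normal : forall i, (Gs i <| G)%g)
    (Gs_cap1 : (\bigcap_(i < n) Gs i)%g = 1%g :> {set gT})
    (psi_isom : forall i, isom (G / Gs i)%g (H i) (psi i)) :
  let C := quasi_uniform_code G (fun i => psi i : coset_of (Gs i) -> hT i) in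
  let d := (n - \max_(A : {set 'I_n} | subgroup_cap G Gs A != 1%g) #|A|)%N in
  is_min_distance C d /\ is_min_weight C d.
Proof.
move=> C d.
have psi_inj i : ('injm (psi i))%g by case/isomP: (psi_isom i).
suff minwt : is_min_weight C d.
  split=> //; apply: min_distance_group => //.
  exact: quasi_uniform_code_group_set.
(* The zero set of a nontrivial element of G is itself an admissible A. *)
have leZ g : g \in G -> g != 1%g ->
    (#|zero_set Gs g| <= \max_(A | subgroup_cap G Gs A != 1%g) #|A|)%N.
  by move=> Gg g1; apply: leq_bigmax_cond; apply/subgroup_cap_neq1; exists g.
split=> [|k [c [/imsetP[g Gg ->] cg1 <-]]]; last first.
  rewrite codeword_neq1 // in cg1.
  by rewrite wt_codeword // leq_sub2l ?leZ.
have cap0 : subgroup_cap G Gs set0 != 1%g.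
  rewrite /subgroup_cap big_set0 setIT.
  by apply: contraNneq G_nonabelian => ->; apply: abelian1.
(* A nontrivial g in the intersection over a largest A: its zero set contains
   A, hence has the same size. *)
have [|A capA maxA] := eq_bigmax_cond (fun A : {set 'I_n} => #|A|)
  (A := [pred A | subgroup_cap G Gs A != 1%g]).
  by apply/card_gt0P; exists set0.
have [g [Gg g1 AZ]] := subgroup_cap_neq1 capA.
exists (codeword (fun i => psi i : coset_of (Gs i) -> hT i) g); split.
- exact: imset_f.
- by rewrite codeword_neq1.
- rewrite wt_codeword // /d; congr subn; apply/eqP.
  by rewrite eqn_leq leZ // [X in (X <= _)%N]maxA subset_leq_card.
Qed.
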